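(* Let $\rho\in(0,1)$ and, for each $n$, let $(X_1,\ldots,X_n)$ be jointly normal with $X_i\sim\mathcal N(\mu_i,1)$, $\mu_i\ge0$, and $\operatorname{Corr}(X_i,X_j)=\rho$ for all $i\neq j$. Suppose $\sup_i\mu_i$ is finite. Then, for any $\alpha\in(0,1)$, $AnyPwr_{Hommel}$ goes to zero as $n\to\infty$.
   Context: Testing problem: test $H_{0i}:\mu_i=0$ against $H_{1i}:\mu_i>0$, $1\le i\le n$ (so always $\mu_i\ge0$). The p-values are $P_i=1-\Phi(X_i)$, with $\Phi$ the standard normal distribution function, and $P_{(1)}\le\cdots\le P_{(n)}$ are the ordered p-values. Hommel's procedure at level $\alpha$: Step 1. Compute $j=\max\{i\in\{1,\ldots,n\}:P_{(n-i+k)}>k\alpha/i\text{ for } k=1,\ldots,i\}$. Step 2. If the maximum in Step 1 does not exist, reject all the hypotheses; otherwise reject all $H_{0i}$ with $P_i\le\alpha/j$. For a multiple testing procedure $T$, $AnyPwr_T=\mathbb P(S_n(T)\ge1)$, where $S_n(T)$ is the number of true positives of $T$, i.e. the number of rejected hypotheses $H_{0i}$, $1\le i\le n$, with $\mu_i>0$. *)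

(* Defs.v *)
From HB Require Import structures.
From mathcomp Require Import all_boot all_order all_algebra.
From mathcomp Require Import all_classical all_reals all_analysis.
Set Implicit Arguments.
Unset Strict Implicit.
Unset Printing Implicit Defensive.
Import Order.TTheory GRing.Theory Num.Theory.
Import numFieldNormedType.Exports.

Local Open Scope classical_set_scope.
Local Open Scope ring_scope.

Section NormalVectors.
Context {R : realType} d {T : measurableType d} (P : probability T R).

(* N(m, s^2). The case s = 0 is separated out because the library's
   normal_prob m 0 is a uniform law on [0, 1] and not the point mass at m. *)
Definition has_normal_law (Y : T -> R) (m s : R) : Prop :=
  forall A : set R, measurable A ->
    P (Y @^-1` A) = if s == 0 then \d_m A else normal_prob m s A.

(* Every linear combination of the coordinates is normal, possibly degenerate. *)
Definition jointly_normal (n : nat) (X : 'I_n -> T -> R) : Prop :=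
  forall a : 'I_n -> R, exists m s : R,
    0 <= s /\ has_normal_law (fun t => \sum_(i < n) a i * X i t) m s.

Definition correlation (Y Z : T -> R) : R :=
  fine (covariance P Y Z) /
    (Num.sqrt (fine 'V_P[Y]) * Num.sqrt (fine 'V_P[Z])).

End NormalVectors.

Definition std_normal_cdf {R : realType} (x : R) : R :=
  fine (normal_prob 0 1 `]-oo, x]).

Definition pvalue {R : realType} (x : R) : R := 1 - std_normal_cdf x.

Section Hommel.
Context {R : realType} {n : nat}.
Implicit Types (p : 'I_n -> R) (alpha : R).

(* The order statistic P_(m) for 1 <= m <= n; the index m is 1-based. *)
Definition ordered_pvalue p (m : nat) : R :=
  nth 0 (sort <=%R [seq p i | i <- enum 'I_n]) m.-1.

(* The index k of the procedure, running over 1, ..., i, is k.+1 below. *)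
Definition hommel_admissible alpha p (i : nat) : bool :=
  (0 < i)%N &&
  [forall k : 'I_i,
    k.+1%:R * alpha / i%:R < ordered_pvalue p (n - i + k.+1)].

Definition hommel_index alpha p : nat :=
  \max_(i < n.+1 | hommel_admissible alpha p i) i.

(* The set of the indices of the rejected hypotheses. *)
Definition hommel alpha p : {set 'I_n} :=
  if [exists i : 'I_n.+1, hommel_admissible alpha p i]
  then [set i | p i <= alpha / (hommel_index alpha p)%:R]%SET
  else [set: 'I_n]%SET.

Definition true_positives (mu : 'I_n -> R) (rejected : {set 'I_n}) : nat :=
  #|[set i in rejected | 0 < mu i]%SET|.

(* A procedure maps the p-values to the set of rejected hypotheses. *)
Definition any_power d (T : measurableType d) (P : probability T R)
    (procedure : ('I_n -> R) -> {set 'I_n}) (mu : 'I_n -> R)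
    (X : 'I_n -> T -> R) : \bar R :=
  P [set t |
     (1 <= true_positives mu (procedure (fun i => pvalue (X i t))))%N].

End Hommel.

(* Main.v *)
(* Write Y_i = X_i - mu_i, Z for the average of the Y_i and r_i = Y_i - Z.
   Hommel's index j is at least the number m of p-values above alpha, so a
   rejected hypothesis has a p-value at most 1/m. On the event Z < K the number
   m is at least a fixed fraction of n with high probability: the residuals r_i
   are pairwise negatively correlated, hence the average of the exp(-theta r_i)
   concentrates around its mean, and for theta large this forces linearly many
   r_i to lie below any prescribed level. A rejection then needs a p-value of
   order 1/n, that is, some X_i of size about sqrt(2 ln n). But X_i <= M + K + r_i
   and the r_i have variance at most 1 - rho < 1, so their maximum only reaches
   about sqrt(2 (1 - rho) ln n). All estimates use nothing but the moment
   generating function of the linear combinations of the Y_i. *)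
Require Import Defs.
From HB Require Import structures.
From mathcomp Require Import all_boot all_order all_algebra.
From mathcomp Require Import all_classical all_reals all_analysis.
From mathcomp Require Import measurable_realfun ring lra.
Import Order.TTheory GRing.Theory Num.Theory.
Import numFieldNormedType.Exports.
Local Open Scope classical_set_scope.
Local Open Scope ring_scope.

(** * Moments of normal laws *)

Section NormalMoments.
Context {R : realType}.

(** [normal_prob m s] is dominated by Lebesgue measure, and its Radon-Nikodym derivative agrees
    almost everywhere with [normal_pdf m s], because both have the same integral over every
    measurable set. *)
Lemma ge0_integral_normal_prob (m s : R) (f : R -> \bar R) : s != 0 ->
  measurable_fun [set: R] f -> (forall x, 0 <= f x)%E ->
  (\int[normal_prob m s]_x f x =
   \int[lebesgue_measure]_x (f x * (normal_pdf m s x)%:E))%E.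
Proof.
move=> s0 mf f0.
have dom := normal_prob_dominates m s.
have mpdf : measurable_fun [set: R] (fun x => (normal_pdf m s x)%:E).
  apply/measurable_EFinP; exact: measurable_normal_pdf.
rewrite -(Radon_Nikodym_SigmaFinite.change_of_variables dom)//.
have intRN := Radon_Nikodym_SigmaFinite.f_integrable dom.
apply: ae_eq_integral => //.
- apply: emeasurable_funM => //; exact: (measurable_int _ intRN).
- exact: emeasurable_funM.
- apply: ae_eqe_mul2l; apply: integral_ae_eq => //.
  by move=> E _ mE; rewrite -Radon_Nikodym_SigmaFinite.f_integral.
Qed.

Lemma normal_pdf_expE (m s x : R) : s != 0 ->
  normal_pdf m s x = normal_peak s * expR (- (x - m) ^+ 2 / (s ^+ 2 *+ 2)).
Proof. by move=> s0; rewrite normal_pdfE. Qed.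

Lemma normal_peak_ratio (s s' : R) : 0 < s -> 0 < s' ->
  normal_peak s = s' / s * normal_peak s'.
Proof.
have E (x : R) : 0 < x -> normal_peak x = x^-1 / Num.sqrt (pi *+ 2).
  move=> x0; rewrite /normal_peak -mulrnAr sqrtrM ?sqr_ge0//.
  by rewrite sqrtr_sqr gtr0_norm// invfM.
by move=> s0 s'0; rewrite !E// mulrA [s' / s]mulrC mulfK// gt_eqF.
Qed.

(** Completing the square: the exponential factor moves the mean of the density from [m] to
    [m + t * s ^+ 2], and what remains to integrate is a normal density. *)
Lemma integral_normal_exp_lin (m s t : R) : s != 0 ->
  (\int[normal_prob m s]_x (expR (t * (x - m)))%:E =
   (expR (t ^+ 2 * s ^+ 2 / 2))%:E)%E.
Proof.
move=> s0; rewrite ge0_integral_normal_prob//; last first.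
- apply/measurable_EFinP; apply: measurableT_comp => //.
  by apply: measurable_funM => //; exact: measurable_funB.
under eq_integral => x _.
  rewrite -EFinM (_ : expR (t * (x - m)) * normal_pdf m s x = expR (t ^+ 2 * s ^+ 2 / 2) *
      normal_pdf (m + t * s ^+ 2) s x); last first.
    rewrite !normal_pdf_expE// [LHS]mulrCA [RHS]mulrCA -!expRD.
    by congr (_ * expR _); field.
  rewrite EFinM; over.
rewrite ge0_integralZl//; first by rewrite integral_normal_pdf mule1.
- apply/measurable_EFinP; exact: measurable_normal_pdf.
- by move=> x _; rewrite lee_fin normal_pdf_ge0.
Qed.

(** The coefficient is the one for which the exponential turns the density with deviation [s] into
    [s' / s] times the density with deviation [s']. It is negative when [s' < s]; both signs serve
    in the computation of the variance. *)
Lemma integral_normal_exp_sqr (m s s' : R) : 0 < s -> 0 < s' ->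
  (\int[normal_prob m s]_x
     (expR ((s ^- 2 - s' ^- 2) / 2 * (x - m) ^+ 2))%:E = (s' / s)%:E)%E.
Proof.
move=> s0 s'0; rewrite ge0_integral_normal_prob ?gt_eqF//; last first.
- apply/measurable_EFinP; apply: measurableT_comp => //.
  apply: measurable_funM => //; apply: measurable_funX.
  exact: measurable_funB.
under eq_integral => x _.
  rewrite -EFinM (_ : expR _ * normal_pdf m s x = s' / s * normal_pdf m s' x); last first.
    rewrite !normal_pdf_expE ?gt_eqF//.
    rewrite (normal_peak_ratio s s')// [LHS]mulrCA [RHS]mulrA; congr (_ * _).
    rewrite -expRD; congr expR.
    by field; rewrite !gt_eqF.
  rewrite EFinM; over.
rewrite ge0_integralZl//; first by rewrite integral_normal_pdf mule1.
- apply/measurable_EFinP; exact: measurable_normal_pdf.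
- by move=> x _; rewrite lee_fin normal_pdf_ge0.
- by rewrite lee_fin divr_ge0// ltW.
Qed.

Context {d} {T : measurableType d} (P : probability T R).

(** Passes to the image measure of [Y], which is a Dirac mass in the degenerate case [s = 0]. *)
Lemma ge0_integral_normal_law (Y : T -> R) (m s : R) (f : R -> \bar R) :
  measurable_fun [set: T] Y -> has_normal_law P Y m s ->
  measurable_fun [set: R] f -> (forall x, 0 <= f x)%E ->
  (\int[P]_t f (Y t) =
    if (s == 0)%R then f m else \int[normal_prob m s]_x f x)%E.
Proof.
move=> mY lawY mf f0.
have -> : (\int[P]_t f (Y t) =
    \int[pushforward P (Y : T -> measurableTypeR R)]_x f x)%E.
  by rewrite ge0_integral_pushforward// preimage_setT.
case: ifPn => [/eqP s0|s0].
  rewrite (@eq_measure_integral _ _ _ _ \d_(m : measurableTypeR R)); last first.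
    by move=> A mA _; have := lawY A mA; rewrite s0 eqxx.
  by rewrite integral_dirac// diracT mul1e.
apply: eq_measure_integral => A mA _.
by have := lawY A mA; rewrite (negbTE s0).
Qed.

Lemma normal_law_mgf (Y : T -> R) (m s t : R) :
  measurable_fun [set: T] Y -> has_normal_law P Y m s ->
  (\int[P]_w (expR (t * (Y w - m)))%:E = (expR (t ^+ 2 * s ^+ 2 / 2))%:E)%E.
Proof.
move=> mY lawY.
rewrite (ge0_integral_normal_law _ _ _ (fun x => (expR (t * (x - m)))%:E) mY lawY).
- case: ifPn => [/eqP ->|s0]; last exact: integral_normal_exp_lin.
  by rewrite subrr mulr0 expr0n/= mulr0 mul0r.
- apply/measurable_EFinP; apply: measurableT_comp => //.
  by apply: measurable_funM => //; exact: measurable_funB.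
- by move=> x; rewrite lee_fin expR_ge0.
Qed.

Lemma normal_law_exp_sqr (Y : T -> R) (m s s' : R) : 0 < s -> 0 < s' ->
  measurable_fun [set: T] Y -> has_normal_law P Y m s ->
  (\int[P]_w (expR ((s ^- 2 - s' ^- 2) / 2 * (Y w - m) ^+ 2))%:E = (s' / s)%:E)%E.
Proof.
move=> s0 s'0 mY lawY.
rewrite (ge0_integral_normal_law _ _ _
  (fun x => (expR ((s ^- 2 - s' ^- 2) / 2 * (x - m) ^+ 2))%:E) mY lawY).
- by rewrite gt_eqF//; exact: integral_normal_exp_sqr.
- apply/measurable_EFinP; apply: measurableT_comp => //.
  apply: measurable_funM => //; apply: measurable_funX.
  exact: measurable_funB.
- by move=> x; rewrite lee_fin expR_ge0.
Qed.


(* Compares 1 + c u^2 <= exp(c u^2), c = (s^-2 - s'^-2) / 2, with the exact value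
   s' / s of the exponential moment, for s' on both sides of s. *)
Lemma normal_law_second_moment (Y : T -> R) (m s : R) : 0 <= s ->
  measurable_fun [set: T] Y -> has_normal_law P Y m s ->
  (\int[P]_w ((Y w - m) ^+ 2)%:E = (s ^+ 2)%:E)%E.
Proof.
move=> s_ge0 mY lawY.
have mf : measurable_fun [set: R] (fun x : R => ((x - m) ^+ 2)%:E).
  apply/measurable_EFinP; apply: measurable_funX; exact: measurable_funB.
have mfY : measurable_fun [set: T] (fun w => ((Y w - m) ^+ 2)%:E).
  by apply: (measurableT_comp mf).
have f0 w : (0 <= ((Y w - m) ^+ 2)%:E)%E by rewrite lee_fin sqr_ge0.
have [s0|s0] := eqVneq s 0.
  rewrite (ge0_integral_normal_law _ _ _ (fun x : R => ((x - m) ^+ 2)%:E) mY lawY)//.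
    by rewrite s0 eqxx subrr.
  by move=> x; rewrite lee_fin sqr_ge0.
have {s_ge0 s0} s_gt0 : 0 < s by rewrite lt_neqAle eq_sym s0.
have mexp c : measurable_fun [set: T] (fun w => (expR (c * (Y w - m) ^+ 2))%:E).
  apply/measurable_EFinP; apply: measurableT_comp => //; apply: measurable_funM => //.
  by move/measurable_EFinP : mfY.
have int1 : (\int[P]_w 1 = 1)%E by rewrite integral_cst//= probability_setT mule1.
pose c s' : R := (s ^- 2 - s' ^- 2) / 2.
have upper s' : s < s' ->
    (1 + (c s')%:E * \int[P]_w ((Y w - m) ^+ 2)%:E <= (s' / s)%:E)%E.
  move=> ss'; have s'0 := lt_trans s_gt0 ss'.
  have c0 : 0 <= c s'.
    rewrite divr_ge0// subr_ge0 lef_pV2 ?posrE ?exprn_gt0//.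
    by rewrite lerXn2r ?nnegrE// ltW.
  rewrite -(normal_law_exp_sqr Y m s s')// -ge0_integralZl// -[X in (X + _)%E]int1.
  rewrite -ge0_integralD//; last 2 first.
  - by move=> w _; rewrite mule_ge0.
  - exact: measurable_funeM.
  apply: ge0_le_integral => //.
  - by move=> w _; rewrite adde_ge0// mule_ge0.
  - by apply: emeasurable_funD => //; exact: measurable_funeM.
  - by move=> w _; rewrite -EFinM -EFinD lee_fin expR_ge1Dx.
have lower s' : 0 < s' -> s' < s ->
    (1 <= (s' / s)%:E + (- c s')%:E * \int[P]_w ((Y w - m) ^+ 2)%:E)%E.
  move=> s'0 ss'.
  have c0 : 0 <= - c s'.
    rewrite -mulNr opprB divr_ge0// subr_ge0 lef_pV2 ?posrE ?exprn_gt0//.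
    by rewrite lerXn2r ?nnegrE// ltW.
  rewrite -(normal_law_exp_sqr Y m s s')// -ge0_integralZl// -[X in (X <= _)%E]int1.
  rewrite -ge0_integralD//; last 2 first.
  - by move=> w _; rewrite mule_ge0.
  - exact: measurable_funeM.
  apply: ge0_le_integral => //.
  - by apply: emeasurable_funD => //; exact: measurable_funeM.
  - move=> w _; rewrite -EFinM -EFinD lee_fin mulNr.
    by have := expR_ge1Dx (c s' * (Y w - m) ^+ 2); lra.
have V0 : (0 <= \int[P]_w ((Y w - m) ^+ 2)%:E)%E by exact: integral_ge0.
have cE s' : 0 < s' -> c s' = (s' - s) * (s' + s) / (2 * s ^+ 2 * s' ^+ 2).
  by move=> s'0; rewrite /c; field; rewrite !gt_eqF.
move: V0 upper lower; case: (\int[P]_w _)%E => [v| |]//; last first.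
  (* An infinite second moment contradicts [upper] at [s + 1], where the coefficient [c] is positive
     and the right-hand side finite. *)
  move=> _ /(_ (s + 1)); rewrite ltrDl ltr01 => /(_ isT).
  have c0 : 0 < c (s + 1).
    have s1 : 0 < s + 1 by lra.
    by rewrite cE// divr_gt0// !mulr_gt0// ?exprn_gt0//; lra.
  by rewrite gt0_muley ?lte_fin// addey.
rewrite lee_fin => v0 upper lower; congr (_%:E).
(* Both halves compare [Num.sqrt v] with [s]: the first uses [s' = s + e] for every [e > 0], the
   second takes for [s'] the midpoint of [Num.sqrt v] and [s]. *)
rewrite -[v]sqr_sqrtr//; congr (_ ^+ 2); apply/eqP; rewrite eq_le; apply/andP; split.
- apply/ler_addgt0Pr => e e0.
  have s'0 : 0 < s + e by lra.
  have := upper (s + e); rewrite ltrDl => /(_ e0).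
  rewrite -EFinM -EFinD lee_fin cE// => le1.
  have {le1} : v * (2 * s + e) <= 2 * s * (s + e) ^+ 2.
    have -> : v * (2 * s + e) = (2 * s ^+ 2 * (s + e) ^+ 2 / e) *
       ((s + e - s) * (s + e + s) / (2 * s ^+ 2 * (s + e) ^+ 2) * v).
      by field; rewrite !gt_eqF.
    have -> : 2 * s * (s + e) ^+ 2 = (2 * s ^+ 2 * (s + e) ^+ 2 / e) * ((s + e) / s - 1).
      by field; rewrite !gt_eqF.
    rewrite ler_pM2l; first by rewrite lerBrDl.
    by rewrite divr_gt0// !mulr_gt0// ?exprn_gt0.
  move=> le2; rewrite -(ger0_norm (ltW s'0)) -sqrtr_sqr; apply: ler_wsqrtr.
  have : v * (2 * s) <= (s + e) ^+ 2 * (2 * s).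
    rewrite [leRHS]mulrC; apply: le_trans le2; rewrite ler_wpM2l//; lra.
  by rewrite ler_pM2r//; lra.
- rewrite leNgt; apply/negP => lts.
  set w := Num.sqrt v in lts *.
  have w0 : 0 <= w by exact: sqrtr_ge0.
  pose s' := (w + s) / 2.
  have s'0 : 0 < s' by rewrite /s'; lra.
  have s's : s' < s by rewrite /s'; lra.
  have ws' : w < s' by rewrite /s'; lra.
  have ss'0 : 0 < s - s' by lra.
  clearbody s'.
  have := lower s' s'0 s's; rewrite -EFinM -EFinD lee_fin cE// => le1.
  have : (2 * s ^+ 2 * s' ^+ 2 / (s - s')) * (1 - s' / s) <=
         (2 * s ^+ 2 * s' ^+ 2 / (s - s')) *
            (- ((s' - s) * (s' + s) / (2 * s ^+ 2 * s' ^+ 2)) * v).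
    rewrite ler_pM2l; first by rewrite lerBlDl.
    by rewrite divr_gt0// !mulr_gt0// ?exprn_gt0.
  have -> : (2 * s ^+ 2 * s' ^+ 2 / (s - s')) * (1 - s' / s) = 2 * s * s' ^+ 2.
    by field; rewrite !gt_eqF// subr_gt0.
  have -> : (2 * s ^+ 2 * s' ^+ 2 / (s - s')) *
            (- ((s' - s) * (s' + s) / (2 * s ^+ 2 * s' ^+ 2)) * v) = (s' + s) * v.
    by field; rewrite !gt_eqF// ?subr_gt0//.
  rewrite -[v]sqr_sqrtr// -/w => le2.
  have : w ^+ 2 < s' ^+ 2.
    by rewrite ltrXn2r ?nnegrE//; exact: ltW.
  nra.
Qed.

End NormalMoments.

(** * The mean of a normal law *)

Section NormalMean.
Context {R : realType} {d} {T : measurableType d} (P : probability T R).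

(** Domination by [1 + f ^+ 2], which is integrable under a probability. *)
Lemma integrable_of_sqr (f : T -> R) (c : R) :
  measurable_fun [set: T] f -> (\int[P]_w ((f w) ^+ 2)%:E = c%:E)%E ->
  P.-integrable [set: T] (EFin \o f).
Proof.
move=> mf fc; have mf2 : measurable_fun [set: T] (fun w => (f w) ^+ 2).
  exact: measurable_funX.
apply: (@le_integrable _ _ _ P _ measurableT _ (fun w => (1 + (f w) ^+ 2)%:E)).
- exact/measurable_EFinP.
- move=> w _ /=; rewrite lee_fin [leRHS]ger0_norm ?addr_ge0 ?sqr_ge0//.
  rewrite -(real_normK (num_real (f w))).
  by have := sqr_ge0 (`|f w| - 1); have := normr_ge0 (f w); nra.
- apply/integrableP; split.
    by apply/measurable_EFinP; exact: measurable_funD.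
  under eq_integral => w _.
    rewrite /= ger0_norm ?addr_ge0 ?sqr_ge0// EFinD; over.
  rewrite ge0_integralD//.
  - by rewrite fc integral_cst//= probability_setT mule1 -EFinD ltry.
  - by move=> w _; rewrite lee_fin sqr_ge0.
  - exact/measurable_EFinP.
Qed.

Lemma normal_law_integrable (Y : T -> R) (m s : R) : 0 <= s ->
  measurable_fun [set: T] Y -> has_normal_law P Y m s ->
  P.-integrable [set: T] (EFin \o (fun w => Y w - m)).
Proof.
move=> s0 mY lawY; apply: (integrable_of_sqr _ (s ^+ 2)).
  exact: measurable_funB.
exact: normal_law_second_moment.
Qed.

(* The line 1 + t E(Y - m) stays below the moment generating function, whose
   derivative at 0 vanishes. *)
Lemma normal_law_mean (Y : T -> R) (m s : R) : 0 <= s ->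
  measurable_fun [set: T] Y -> has_normal_law P Y m s ->
  (\int[P]_w (Y w - m)%:E = 0)%E.
Proof.
move=> s0 mY lawY; have intY := normal_law_integrable Y m s s0 mY lawY.
have mexp t : measurable_fun [set: T] (fun w => (expR (t * (Y w - m)))%:E).
  apply/measurable_EFinP; apply: measurableT_comp => //.
  by apply: measurable_funM => //; exact: measurable_funB.
have int_exp t : P.-integrable [set: T] (fun w => (expR (t * (Y w - m)))%:E).
  apply/integrableP; split => //.
  under eq_integral => w _ do rewrite /= ger0_norm ?expR_ge0//.
  by rewrite (normal_law_mgf P Y m s)// ltry.
have fin : (\int[P]_w (Y w - m)%:E)%E \is a fin_num by exact: integrable_fin_num.
rewrite -(fineK fin); set e := fine _; congr (_%:E).
have tangent t : 1 + t * e <= expR (t ^+ 2 * s ^+ 2 / 2).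
  rewrite -lee_fin -(normal_law_mgf P Y m s)// EFinD EFinM fineK//.
  rewrite -integralZl// -[X in (X + _ <= _)%E]mule1 -[X in (_ * X + _ <= _)%E](@probability_setT _ _ _ P).
  rewrite -integral_cst// -integralD//.
  - apply: le_integral => //.
      by apply: integrableD => //; [exact: finite_measure_integrable_cst|exact: integrableZl].
    by move=> w _; rewrite -EFinM -EFinD lee_fin expR_ge1Dx.
  - exact: finite_measure_integrable_cst.
  - exact: integrableZl.
apply: contrapT => /eqP e0.
(* The tangent inequality is tested at [t = e / k]. This [k] makes [e ^+ 2 / k] and [s ^+ 2 / k] at
   most 1, so the linear gain [e ^+ 2 / k] beats the quadratic exponent [x]. The exponential is
   bounded from above through [1 - x <= expR (- x)]. *)
pose k := (s ^+ 2 + 1) * (1 + e ^+ 2).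
have s2 : 0 <= s ^+ 2 by exact: sqr_ge0.
have e2 : 0 < e ^+ 2 by rewrite exprn_even_gt0.
have k0 : 0 < k by rewrite mulr_gt0//; lra.
pose x := e ^+ 2 * s ^+ 2 / (2 * k ^+ 2).
have xE : x = (e ^+ 2 / k) * (s ^+ 2 / k) / 2 by rewrite /x; field; rewrite gt_eqF.
have a1 : e ^+ 2 / k <= 1 by rewrite ler_pdivrMr// mul1r /k; nra.
have b1 : s ^+ 2 / k < 1 by rewrite ltr_pdivrMr// mul1r /k; nra.
have a0 : 0 < e ^+ 2 / k by rewrite divr_gt0.
have b0 : 0 <= s ^+ 2 / k by rewrite divr_ge0// ltW.
have := tangent (e / k).
have -> : (e / k) ^+ 2 * s ^+ 2 / 2 = x by rewrite /x; field; rewrite gt_eqF.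
have -> : e / k * e = e ^+ 2 / k by ring.
move=> le1; have := expR_ge1Dx (- x); rewrite expRN => le2.
have x1 : 0 < 1 - x by rewrite xE; nra.
have : (1 + e ^+ 2 / k) * (1 - x) <= 1.
  rewrite -[leRHS](@mulfV _ (expR x)) ?gt_eqF ?expR_gt0//.
  by apply: ler_pM => //; [lra | exact: ltW].
by rewrite xE; nra.
Qed.

End NormalMean.

(** * Equicorrelated normal vectors *)

Section Equicorrelated.
Context {R : realType} {d} {T : measurableType d} (P : probability T R).
Context {n : nat} (rho : R) (mu : 'I_n -> R) (X : 'I_n -> T -> R).
Hypothesis mX : forall i, measurable_fun [set: T] (X i).
Hypothesis X_normal : jointly_normal P X.
Hypothesis X_marginal : forall i, has_normal_law P (X i) (mu i) 1.
Hypothesis X_corr : forall i j, i != j -> correlation P (X i) (X j) = rho.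

Let Y i w := X i w - mu i.

Let mY i : measurable_fun [set: T] (Y i).
Proof. exact: measurable_funB. Qed.

Let intY i : P.-integrable [set: T] (EFin \o Y i).
Proof. exact: (normal_law_integrable P (X i) (mu i) 1). Qed.

Let meanY i : (\int[P]_w (Y i w)%:E = 0)%E.
Proof. exact: (normal_law_mean P (X i) (mu i) 1). Qed.

Let sqrY i : (\int[P]_w ((Y i w) ^+ 2)%:E = 1)%E.
Proof. by rewrite (normal_law_second_moment P (X i) (mu i) 1)// expr1n. Qed.

Let intYY i j : P.-integrable [set: T] (EFin \o (fun w => Y i w * Y j w)).
Proof.
have mYY : measurable_fun [set: T] (fun w => Y i w * Y j w) by exact: measurable_funM.
apply: (@le_integrable _ _ _ P _ measurableT _
  (fun w => ((Y i w) ^+ 2 + (Y j w) ^+ 2)%:E)).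
- exact/measurable_EFinP.
- move=> w _ /=; rewrite lee_fin [leRHS]ger0_norm ?addr_ge0 ?sqr_ge0// normrM.
  rewrite -(real_normK (num_real (Y i w))) -(real_normK (num_real (Y j w))).
  by have := sqr_ge0 (`|Y i w| - `|Y j w|);
     have := sqr_ge0 (`|Y i w| + `|Y j w|); nra.
- have intsqr k : P.-integrable [set: T] (fun w => ((Y k w) ^+ 2)%:E).
    apply/integrableP; split; first exact/measurable_EFinP/measurable_funX.
    under eq_integral => w _ do rewrite /= ger0_norm ?sqr_ge0//.
    by rewrite sqrY ltry.
  exact: (integrableD _ (intsqr i) (intsqr j)).
Qed.

Let EX i : ('E_P[X i] = (mu i)%:E)%E.
Proof.
rewrite unlock.
under eq_integral => w _.
  rewrite (_ : X i w = Y i w + mu i); last by rewrite subrK.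
  rewrite EFinD; over.
rewrite integralD//; [|exact: intY|exact: finite_measure_integrable_cst].
by rewrite meanY add0e integral_cst//= probability_setT mule1.
Qed.

Let covX i j : covariance P (X i) (X j) = (\int[P]_w (Y i w * Y j w)%:E)%E.
Proof. by rewrite unlock !EX unlock. Qed.

Let meanYY i j : (\int[P]_w (Y i w * Y j w)%:E = (if i == j then 1 else rho)%:E)%E.
Proof.
have [<-|ij] := eqVneq i j.
  by rewrite -(sqrY i); apply: eq_integral => w _; rewrite expr2.
have V k : ('V_P[X k] = 1)%E.
  by rewrite /variance covX -(sqrY k); apply: eq_integral => w _; rewrite expr2.
have := X_corr i j ij; rewrite /correlation !V covX /= sqrtr1 mulr1 divr1 => <-.
by rewrite fineK//; exact: (integrable_fin_num measurableT (intYY i j)).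
Qed.

Let combo (a : 'I_n -> R) w : \sum_i a i * X i w - \sum_i a i * mu i = \sum_i a i * Y i w.
Proof. by rewrite -sumrB; apply: eq_bigr => i _; rewrite mulrBr. Qed.

(** Joint normality only supplies some [m] and [s] for the combination. The first two moments
    identify them: [m] is the combination of the means, and [s ^+ 2] is the quadratic form of the
    equicorrelation matrix. The claim is then the moment generating function at 1. *)
Lemma equicorrelated_mgf (a : 'I_n -> R) :
  (\int[P]_w (expR (\sum_i a i * (X i w - mu i)))%:E =
   (expR (((1 - rho) * \sum_i a i ^+ 2 + rho * (\sum_i a i) ^+ 2) / 2))%:E)%E.
Proof.
have [m [s [s0 lawS]]] := X_normal a.
pose S w := \sum_i a i * X i w; have mS : measurable_fun [set: T] S.
  by apply: measurable_sum => i; exact: measurable_funM.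
have intaY i : P.-integrable [set: T] (fun w => (a i * Y i w)%:E).
  exact: (integrableZl measurableT (a i) (intY i)).
have meanS : (\int[P]_w (\sum_i a i * Y i w)%:E = 0)%E.
  under eq_integral => w _ do rewrite -sumEFin.
  rewrite integral_sum// big1// => i _.
  under eq_integral => w _ do rewrite EFinM.
  by rewrite integralZl//; [rewrite meanY mule0 | exact: intY].
have mE : m = \sum_i a i * mu i.
  have := normal_law_mean P S m s s0 mS lawS.
  under eq_integral => w _.
    rewrite (_ : S w - m = \sum_i a i * Y i w + (\sum_i a i * mu i - m)); last first.
      by rewrite -combo addrA subrK.
    rewrite EFinD; over.
  rewrite integralD//; last 2 first.
  - under eq_fun do rewrite -sumEFin; exact: integrable_sum.
  - exact: finite_measure_integrable_cst.
  rewrite meanS add0e integral_cst//= probability_setT mule1 => -[] /eqP.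
  by rewrite subr_eq0 => /eqP.
have sE : s ^+ 2 = (1 - rho) * \sum_i a i ^+ 2 + rho * (\sum_i a i) ^+ 2.
  suff : (s ^+ 2)%:E = ((1 - rho) * \sum_i a i ^+ 2 + rho * (\sum_i a i) ^+ 2)%:E by case.
  rewrite -(normal_law_second_moment P S m s)//.
  have -> : (\int[P]_w ((S w - m) ^+ 2)%:E =
      \int[P]_w (\sum_i \sum_j (a i * Y i w * (a j * Y j w))%:E))%E.
    apply: eq_integral => w _; rewrite mE combo expr2 mulr_suml -sumEFin.
    by apply: eq_bigr => i _; rewrite mulr_sumr -sumEFin.
  have intaYY i j : P.-integrable [set: T] (fun w => (a i * Y i w * (a j * Y j w))%:E).
    under eq_fun do rewrite mulrACA.
    exact: (integrableZl measurableT (a i * a j) (intYY i j)).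
  rewrite integral_sum//; last by move=> i; exact: integrable_sum.
  under eq_bigr => i _.
    rewrite integral_sum//.
    under eq_bigr => j _.
      under eq_integral => w _ do rewrite mulrACA EFinM.
      rewrite integralZl//; last exact: intYY.
      rewrite meanYY -EFinM; over.
    rewrite sumEFin; over.
  rewrite sumEFin; congr (_%:E).
  (* The diagonal weight 1 is split as [(1 - rho) + rho], and the [rho] part completes the
     off-diagonal sum to a full square. *)
  transitivity (\sum_i ((1 - rho) * a i ^+ 2 + rho * (a i * \sum_j a j))).
    apply: eq_bigr => i _; rewrite (bigD1 i)//= eqxx [in RHS](bigD1 i)//= mulrDr mulrDr.
    rewrite addrA; congr (_ + _); first by ring.
    rewrite 2!mulr_sumr; apply: eq_bigr => j ji.
    by rewrite eq_sym (negbTE ji) mulrC.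
  by rewrite big_split/= -!mulr_sumr -mulr_suml expr2.
have := normal_law_mgf P S m s 1 mS lawS; rewrite expr1n mul1r -sE => <-.
by apply: eq_integral => w _; rewrite mul1r mE combo.
Qed.

End Equicorrelated.

(** * Tail bounds for the average and for the residuals *)

Lemma markov_ge0 {R : realType} {d} {T : measurableType d} (P : probability T R)
    (f : T -> R) (a b : R) : 0 < a ->
  measurable_fun [set: T] f -> (forall w, 0 <= f w) ->
  (\int[P]_w (f w)%:E <= b%:E)%E -> (P [set w | a <= f w]%R <= (b / a)%:E)%E.
Proof.
move=> a0 mf f0 fb; rewrite EFinM lee_pdivlMr//.
have mA : measurable [set w | a <= f w].
  by rewrite -[X in measurable X]setTI; apply: measurable_fun_le.
apply: le_trans fb.
rewrite muleC -[X in P X]setIT -integral_indic// -ge0_integralZl//; last 2 first.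
- exact/measurable_EFinP/measurable_indic.
- by rewrite lee_fin ltW.
apply: ge0_le_integral => //.
- by move=> w _; rewrite mule_ge0 ?lee_fin// ltW.
- by apply: measurable_funeM; exact/measurable_EFinP/measurable_indic.
- exact/measurable_EFinP.
- move=> w _; rewrite -EFinM lee_fin indicE.
  by case: (boolP (w \in _)) => [|_]; rewrite ?inE/= ?mulr1// mulr0.
Qed.

Section Concentration.
Context {R : realType} {d} {T : measurableType d} (P : probability T R).
Context {n : nat} (rho : R) (Y : 'I_n -> T -> R).
Hypothesis n_gt0 : (0 < n)%N.
Hypothesis rho0 : 0 < rho.
Hypothesis rho1 : rho < 1.
Hypothesis mY : forall i, measurable_fun [set: T] (Y i).
Hypothesis mgfY : forall a : 'I_n -> R,
  (\int[P]_w (expR (\sum_i a i * Y i w))%:E =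
   (expR (((1 - rho) * \sum_i a i ^+ 2 + rho * (\sum_i a i) ^+ 2) / 2))%:E)%E.

Definition average (w : T) : R := (\sum_i Y i w) / n%:R.
Definition residual (i : 'I_n) (w : T) : R := Y i w - average w.

Let n0 : n%:R != 0 :> R. Proof. by rewrite pnatr_eq0 -lt0n. Qed.
Let npos : 0 < n%:R :> R. Proof. by rewrite ltr0n. Qed.
Let n1 : 1 <= n%:R :> R. Proof. by rewrite ler1n. Qed.
Let invn : n%:R^-1 <= 1 :> R. Proof. by rewrite invf_le1. Qed.
Let invn0 : 0 < n%:R^-1 :> R. Proof. by rewrite invr_gt0. Qed.

Let sum_cst (c : R) : \sum_(i < n) c = n%:R * c.
Proof. by rewrite sumr_const card_ord mulr_natl. Qed.

Lemma measurable_average : measurable_fun [set: T] average.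
Proof. by apply: measurable_funM => //; exact: measurable_sum. Qed.

Lemma measurable_residual i : measurable_fun [set: T] (residual i).
Proof. by apply: measurable_funB => //; exact: measurable_average. Qed.

Lemma average_mgf (t : R) :
  (\int[P]_w (expR (t * average w))%:E =
   (expR (t ^+ 2 * (rho + (1 - rho) / n%:R) / 2))%:E)%E.
Proof.
transitivity (\int[P]_w (expR (\sum_(i < n) t / n%:R * Y i w))%:E)%E.
  by apply: eq_integral => w _; rewrite -mulr_sumr /average mulrA mulrAC.
rewrite mgfY !sum_cst; congr ((expR _)%:E).
by field.
Qed.

(** Chernoff's bound with parameter 1. The variance [rho + (1 - rho) / n%:R] is at most 1, so the
    bound is uniform in [n]. *)
Lemma average_upper_tail (K : R) :
  (P [set w | K <= average w]%R <= (expR (1 / 2 - K))%:E)%E.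
Proof.
have -> : [set w | K <= average w] = [set w | expR K <= expR (1 * average w)].
  by apply/seteqP; split => w /=; rewrite ler_expR mul1r.
rewrite expRB; apply: markov_ge0 => //; first exact: expR_gt0.
- by apply: measurableT_comp => //; apply: measurable_funM => //; exact: measurable_average.
- have r1 := rho1.
  have : (1 - rho) / n%:R <= 1 - rho by rewrite ler_piMr ?invn//; lra.
  by rewrite average_mgf lee_fin ler_expR; lra.
Qed.

(** Combining the residuals with coefficients [c i] is combining the [Y i] with the centred
    coefficients [c i - C / n%:R]. These sum to zero, which removes the term in [rho]. *)
Lemma residual_mgf (t : R) (c : 'I_n -> R) :
  (\int[P]_w (expR (t * \sum_i c i * residual i w))%:E =
   (expR (t ^+ 2 * (1 - rho) *
     (\sum_i c i ^+ 2 - (\sum_i c i) ^+ 2 / n%:R) / 2))%:E)%E.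
Proof.
set C := \sum_i c i.
transitivity (\int[P]_w (expR (\sum_(i < n) (t * (c i - C / n%:R)) * Y i w))%:E)%E.
  apply: eq_integral => w _; congr ((expR _)%:E).
  under [RHS]eq_bigr do rewrite -mulrA mulrBl.
  rewrite -mulr_sumr sumrB; congr (_ * _).
  under eq_bigr do rewrite mulrBr.
  by rewrite sumrB -mulr_suml -mulr_sumr -/C /average; congr (_ - _); ring.
rewrite mgfY; congr ((expR _)%:E).
have -> : \sum_i t * (c i - C / n%:R) = 0.
  rewrite -mulr_sumr sumrB sum_cst -/C.
  by rewrite [n%:R * _]mulrC divfK// subrr mulr0.
have -> : \sum_i (t * (c i - C / n%:R)) ^+ 2 = t ^+ 2 * (\sum_i c i ^+ 2 - C ^+ 2 / n%:R).
  under eq_bigr do rewrite exprMn.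
  rewrite -mulr_sumr; congr (_ * _).
  transitivity (\sum_i (c i ^+ 2 - 2 * (C / n%:R) * c i + (C / n%:R) ^+ 2)).
    by apply: eq_bigr => i _; ring.
  rewrite big_split/= sumrB -mulr_sumr sum_cst -/C.
  by field.
by rewrite expr0n/= mulr0 addr0; ring.
Qed.

Definition residual_variance : R := (1 - rho) * (1 - n%:R^-1).

Let sum_delta (i : 'I_n) (F : 'I_n -> R) : \sum_k (k == i)%:R * F k = F i.
Proof.
rewrite (bigD1 i)//= eqxx mul1r big1 ?addr0// => k ki.
by rewrite (negbTE ki) mul0r.
Qed.

Lemma residual_mgf1 (t : R) i :
  (\int[P]_w (expR (t * residual i w))%:E =
   (expR (t ^+ 2 * residual_variance / 2))%:E)%E.
Proof.
have := residual_mgf t (fun k => (k == i)%:R).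
under eq_integral => w _ do rewrite sum_delta.
move=> ->; congr ((expR _)%:E).
under eq_bigr do rewrite expr2.
rewrite sum_delta eqxx.
under eq_bigr do rewrite -[_%:R]mulr1.
by rewrite sum_delta /residual_variance expr1n div1r mulrA.
Qed.

(** Distinct residuals have covariance [- (1 - rho) / n%:R], which is negative, so the joint moment
    is at most the product of the two single moments, as under independence. *)
Lemma residual_mgf2 (t : R) i j : i != j ->
  (\int[P]_w (expR (t * (residual i w + residual j w)))%:E <=
   (expR (t ^+ 2 * residual_variance))%:E)%E.
Proof.
move=> ij; have := residual_mgf t (fun k => (k == i)%:R + (k == j)%:R).
under eq_integral => w _.
  under eq_bigr do rewrite mulrDl.
  rewrite big_split/= !sum_delta; over.
move=> ->; rewrite lee_fin ler_expR /residual_variance.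
have -> : \sum_(k < n) ((k == i)%:R + (k == j)%:R : R) = 2.
  rewrite big_split/=.
  under eq_bigr do rewrite -[_%:R]mulr1.
  under [X in _ + X]eq_bigr do rewrite -[_%:R]mulr1.
  by rewrite !sum_delta.
have -> : \sum_(k < n) ((k == i)%:R + (k == j)%:R : R) ^+ 2 = 2.
  under eq_bigr do rewrite expr2 mulrDl.
  by rewrite big_split/= !sum_delta !eqxx (negbTE ij) eq_sym (negbTE ij) addr0 add0r.
have r1 := rho1.
have : 0 <= t ^+ 2 * (1 - rho) * n%:R^-1 by rewrite mulr_ge0 ?(ltW invn0)// mulr_ge0 ?sqr_ge0//; lra.
nra.
Qed.

Lemma residual_variance_le : residual_variance <= 1 - rho.
Proof. by have := rho1; have := invn; have := invn0; rewrite /residual_variance; nra. Qed.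

Lemma residual_upper_tail (lam v : R) i : 0 < lam ->
  (P [set w | v <= residual i w]%R <= (expR (lam ^+ 2 * (1 - rho) / 2 - lam * v))%:E)%E.
Proof.
move=> lam0.
have -> : [set w | v <= residual i w] =
    [set w | expR (lam * v) <= expR (lam * residual i w)].
  by apply/seteqP; split => w /=; rewrite ler_expR ler_pM2l.
rewrite expRB; apply: markov_ge0 => //; first exact: expR_gt0.
- by apply: measurableT_comp => //; apply: measurable_funM => //; exact: measurable_residual.
- rewrite residual_mgf1 lee_fin ler_expR ler_wpM2r// ler_wpM2l ?sqr_ge0//.
  exact: residual_variance_le.
Qed.

Lemma residual_max_upper_tail (lam v : R) : 0 < lam ->
  (P (\big[setU/set0]_(i < n) [set w | v <= residual i w]%R) <=
   (n%:R * expR (lam ^+ 2 * (1 - rho) / 2 - lam * v))%:E)%E.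
Proof.
move=> lam0.
have mA i : measurable [set w | v <= residual i w].
  rewrite -[X in measurable X]setTI; apply: measurable_fun_le => //.
  exact: measurable_residual.
set b := expR _; have -> : (n%:R * b)%:E = (\sum_(i < n) b%:E)%E.
  by rewrite sumEFin sum_cst.
suff [] : measurable (\big[setU/set0]_(i < n) [set w | v <= residual i w]%R) /\
  (P (\big[setU/set0]_(i < n) [set w | v <= residual i w]%R) <= \sum_(i < n) b%:E)%E by [].
(* Measurability travels along the induction because subadditivity requires it of both sets. *)
apply: (big_ind2 (fun B x => measurable B /\ (P B <= x)%E)).
- by rewrite measure0.
- move=> B1 x1 B2 x2 [mB1 le1] [mB2 le2]; split; first exact: measurableU.
  by rewrite (le_trans (measureU2 _ _ _))// leeD.
- by move=> i _; split => //; exact: residual_upper_tail.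
Qed.

Let ge0_integral_average (F : 'I_n -> T -> R) :
  (forall i, measurable_fun [set: T] (F i)) -> (forall i w, 0 <= F i w) ->
  (\int[P]_w ((\sum_i F i w) / n%:R)%:E =
   (n%:R^-1)%:E * \sum_i \int[P]_w (F i w)%:E)%E.
Proof.
move=> mF F0; under eq_integral => w _ do rewrite mulrC EFinM -sumEFin.
have mF' i : measurable_fun [set: T] (fun w => (F i w)%:E) by exact/measurable_EFinP.
rewrite ge0_integralZl//.
- by rewrite ge0_integral_sum// => i w _; rewrite lee_fin.
- exact: emeasurable_sum.
- by move=> w _; apply: sume_ge0 => i _; rewrite lee_fin.
Qed.

(** * The average of the exponentials of the residuals *)

Section ExponentialStatistic.
Variable theta : R.
Let W i w := expR (- theta * residual i w).
Let A := expR (theta ^+ 2 * residual_variance / 2).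

Let mW i : measurable_fun [set: T] (W i).
Proof.
by apply: measurableT_comp => //; apply: measurable_funM => //; exact: measurable_residual.
Qed.

Let W0 i w : 0 <= W i w. Proof. exact: expR_ge0. Qed.

Let meanW i : (\int[P]_w (W i w)%:E = A%:E)%E.
Proof. by rewrite residual_mgf1 sqrrN. Qed.

Let meanW2 i : (\int[P]_w (W i w ^+ 2)%:E <= (expR (2 * theta ^+ 2))%:E)%E.
Proof.
have -> : (\int[P]_w (W i w ^+ 2)%:E =
    \int[P]_w (expR (- (2 * theta) * residual i w))%:E)%E.
  by apply: eq_integral => w _; rewrite expr2 /W -expRD; congr ((expR _)%:E); ring.
rewrite residual_mgf1 lee_fin ler_expR sqrrN.
have r0 := rho0; have := residual_variance_le; have := sqr_ge0 theta; nra.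
Qed.

Let meanWW i j : (\int[P]_w (W i w * W j w)%:E <=
  (A ^+ 2 + (i == j)%:R * expR (2 * theta ^+ 2))%:E)%E.
Proof.
have [<-|ij] := eqVneq i j.
  under eq_integral => w _ do rewrite -expr2.
  apply: le_trans (meanW2 i) _.
  by rewrite lee_fin mul1r lerDr sqr_ge0.
have -> : (\int[P]_w (W i w * W j w)%:E =
    \int[P]_w (expR (- theta * (residual i w + residual j w)))%:E)%E.
  by apply: eq_integral => w _; rewrite /W -expRD; congr ((expR _)%:E); ring.
rewrite (le_trans (residual_mgf2 _ _ _ ij))// lee_fin mul0r addr0 /A -expRM_natr.
by rewrite ler_expR sqrrN; lra.
Qed.

Let avgW w := (\sum_i W i w) / n%:R.

(* Chebyshev's inequality; the off-diagonal covariances are nonpositive. *)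
Lemma average_exp_lower_tail :
  (P [set w | (\sum_i W i w) / n%:R <= A - 1]%R <= (expR (2 * theta ^+ 2) / n%:R)%:E)%E.
Proof.
have mavg : measurable_fun [set: T] avgW.
  by apply: measurable_funM => //; exact: measurable_sum.
have avg0 w : 0 <= avgW w by rewrite divr_ge0// sumr_ge0.
have A0 : 0 <= A by exact: expR_ge0.
have Eavg : (\int[P]_w (avgW w)%:E = A%:E)%E.
  rewrite ge0_integral_average//.
  under eq_bigr do rewrite meanW.
  by rewrite sumEFin sum_cst -EFinM mulKf.
(* In [meanWW] only the [n] diagonal products receive more than [A ^+ 2]; averaged over all pairs,
   this excess is of order [1 / n]. *)
have Eavg2 : (\int[P]_w ((avgW w) ^+ 2)%:E <=
    (A ^+ 2 + expR (2 * theta ^+ 2) / n%:R)%:E)%E.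
  have -> : (\int[P]_w ((avgW w) ^+ 2)%:E =
      \int[P]_w ((\sum_i (\sum_j W i w * W j w) / n%:R) / n%:R)%:E)%E.
    apply: eq_integral => w _; congr (_%:E).
    under eq_bigr do rewrite -mulr_sumr.
    by rewrite -!mulr_suml /avgW; ring.
  rewrite ge0_integral_average//; last 2 first.
  - by move=> i; apply: measurable_funM => //; apply: measurable_sum => j; exact: measurable_funM.
  - by move=> i w; rewrite divr_ge0// sumr_ge0// => j _; exact: mulr_ge0.
  apply: (@le_trans _ _ ((n%:R^-1)%:E * \sum_(i < n) (A ^+ 2 + expR (2 * theta ^+ 2) / n%:R)%:E)%E);
    last by rewrite sumEFin sum_cst -EFinM mulKf.
  rewrite lee_wpmul2l ?lee_fin ?(ltW invn0)//; apply: lee_sum => i _.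
  rewrite ge0_integral_average//; last 2 first.
  - by move=> j; exact: measurable_funM.
  - by move=> j w; exact: mulr_ge0.
  apply: (@le_trans _ _ ((n%:R^-1)%:E *
      \sum_(j < n) (A ^+ 2 + (i == j)%:R * expR (2 * theta ^+ 2))%:E)%E).
    by rewrite lee_wpmul2l ?lee_fin ?(ltW invn0)//; apply: lee_sum => j _; exact: meanWW.
  rewrite sumEFin -EFinM lee_fin big_split/= sum_cst.
  under [X in _ + X]eq_bigr do rewrite eq_sym.
  by rewrite sum_delta mulrDr mulKf// [_^-1 * _]mulrC.
have Ef : (\int[P]_w ((avgW w - A) ^+ 2)%:E <= (expR (2 * theta ^+ 2) / n%:R)%:E)%E.
  have msq : measurable_fun [set: T] (fun w => (avgW w - A) ^+ 2).
    by apply: measurable_funX; exact: measurable_funB.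
  have msq2 : measurable_fun [set: T] (fun w => avgW w ^+ 2) by exact: measurable_funX.
  have A20 : (0 <= (2 * A)%:E)%E by rewrite lee_fin mulr_ge0.
  (* The expansion of the variance is stated with sums on both sides, so that only integrals of
     nonnegative functions occur. *)
  have eqf : (\int[P]_w ((avgW w - A) ^+ 2)%:E + (2 * A)%:E * \int[P]_w (avgW w)%:E =
          \int[P]_w ((avgW w) ^+ 2)%:E + (A ^+ 2)%:E)%E.
    rewrite -[X in (_ = _ + X)%E]mule1 -[X in (_ = _ + _ * X)%E](@probability_setT _ _ _ P).
    rewrite -integral_cst// -ge0_integralZl//; last 2 first.
    - exact/measurable_EFinP.
    - by move=> w _; rewrite lee_fin.
    rewrite -!ge0_integralD//.
    + by apply: eq_integral => w _; rewrite /= -EFinM -!EFinD; congr (_%:E); ring.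
    + by move=> w _; rewrite lee_fin sqr_ge0.
    + exact/measurable_EFinP.
    + by move=> w _; rewrite lee_fin sqr_ge0.
    + by move=> w _; rewrite lee_fin sqr_ge0.
    + exact/measurable_EFinP.
    + by move=> w _; rewrite mule_ge0// lee_fin.
    + by apply: measurable_funeM; exact/measurable_EFinP.
  rewrite -(@leeD2rE _ ((2 * A)%:E * A%:E)%E)// -{1}Eavg eqf -EFinM -EFinD.
  apply: le_trans (leeD2r _ Eavg2) _.
  by rewrite -EFinD lee_fin; nra.
have := markov_ge0 P (fun w => (avgW w - A) ^+ 2) 1 _ ltr01 _ _ Ef.
rewrite divr1 => mk; apply: le_trans (mk _ _); last 2 first.
- by apply: measurable_funX; exact: measurable_funB.
- by move=> w; exact: sqr_ge0.
have msub : measurable_fun [set: T] (fun w => (avgW w - A) ^+ 2).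
  by apply: measurable_funX; exact: measurable_funB.
apply: le_measure; rewrite ?inE.
- by rewrite -[X in measurable X]setTI; exact: measurable_fun_le.
- by rewrite -[X in measurable X]setTI; exact: measurable_fun_le.
- by move=> w /=; rewrite -/(avgW w) => h; nra.
Qed.

(** Markov's inequality. It keeps the average of the [W i] from being carried by a few huge terms,
    so that a large average forces many indices to contribute in [large_pvalues_card]. *)
Lemma average_sqr_exp_upper_tail (D : R) : 0 < D ->
  (P [set w | D / 2 <= (\sum_i W i w ^+ 2) / n%:R]%R <=
    (2 * expR (2 * theta ^+ 2) / D)%:E)%E.
Proof.
move=> D0; have mW2 i : measurable_fun [set: T] (fun w => W i w ^+ 2) by exact: measurable_funX.
have W20 i w : 0 <= W i w ^+ 2 by exact: sqr_ge0.
rewrite (_ : 2 * expR _ / D = expR (2 * theta ^+ 2) / (D / 2)); last first.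
  by field; rewrite gt_eqF.
apply: markov_ge0.
- by rewrite divr_gt0.
- by apply: measurable_funM => //; exact: measurable_sum.
- by move=> w; rewrite divr_ge0// sumr_ge0.
- rewrite ge0_integral_average//.
  apply: (@le_trans _ _ ((n%:R^-1)%:E * \sum_(i < n) (expR (2 * theta ^+ 2))%:E)%E);
    last by rewrite sumEFin sum_cst -EFinM mulKf.
  by rewrite lee_wpmul2l ?lee_fin ?(ltW invn0)//; apply: lee_sum => i _; exact: meanW2.
Qed.

End ExponentialStatistic.
End Concentration.

(** * p-values *)

Section NormalTail.
Context {R : realType}.

Lemma std_normal_cdfE (x : R) :
  (std_normal_cdf x)%:E = normal_prob 0 1 `]-oo, x]%classic.
Proof. by rewrite fineK// fin_num_measure. Qed.

Lemma std_normal_cdf_nondecreasing : {homo @std_normal_cdf R : x y / x <= y}.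
Proof.
move=> x y xy; rewrite -lee_fin !std_normal_cdfE.
by apply: le_measure; rewrite ?inE//; exact: subitvPr.
Qed.

Lemma measurable_pvalue : measurable_fun [set: R] (@pvalue R).
Proof.
apply: measurable_funB => //.
exact: (nondecreasing_measurable measurableT std_normal_cdf_nondecreasing).
Qed.

(** Chernoff's bound with parameter -1. *)
Lemma std_normal_cdf_lower_tail (c : R) : std_normal_cdf c <= expR (1 / 2 + c).
Proof.
rewrite -lee_fin std_normal_cdfE.
have -> : `]-oo, c]%classic = [set w : R | expR (- c) <= expR (-1 * (w - 0))].
  by apply/seteqP; split => w /=; rewrite in_itv/= ler_expR subr0 mulN1r lerN2.
rewrite -[c in (_ + c)%R]opprK expRB.
have : (\int[normal_prob 0 1]_w (expR (-1 * (w - 0 : R)))%:E <= (expR (1 / 2))%:E)%E.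
  by rewrite integral_normal_exp_lin ?oner_neq0// sqrrN !expr1n mulr1.
apply: (markov_ge0 (normal_prob 0 1 : probability (measurableTypeR R) R)) => //.
- exact: expR_gt0.
- apply: measurableT_comp => //; apply: measurable_funM => //; exact: measurable_funB.
Qed.

Lemma pvalue_gt (alpha : R) : alpha < 1 ->
  exists c, forall x, x <= c -> alpha < pvalue x.
Proof.
(* At this point the tail bound equals [(1 - alpha) * expR (- 1 / 2)], strictly below
   [1 - alpha]. *)
move=> a1; exists (ln (1 - alpha) - 1) => x xc.
have := std_normal_cdf_nondecreasing _ _ xc.
have := std_normal_cdf_lower_tail (ln (1 - alpha) - 1).
have : expR (1 / 2 + (ln (1 - alpha) - 1)) < 1 - alpha.
  by rewrite -[ltRHS]lnK ?posrE ?subr_gt0// ltr_expR; lra.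
rewrite /pvalue; lra.
Qed.

(** The interval from [y - 1] to [y] has length 1 and lies above [x], and on it the density is at
    least its value at [y], since [0 <= y - 1]. Giving up one unit in [x] thus avoids the polynomial
    factor of the exact tail. *)
Lemma pvalue_lower_bound (x y : R) : 1 <= y -> x <= y - 1 ->
  normal_peak 1 * expR (- y ^+ 2 / 2) <= pvalue x.
Proof.
move=> y1 xy; rewrite /pvalue lerBrDr -lee_fin EFinD std_normal_cdfE.
pose I : set (measurableTypeR R) := `]y - 1, y]%classic.
pose J : set (measurableTypeR R) := `]-oo, x]%classic.
have mI : measurable I by exact: measurable_itv.
have mJ : measurable J by exact: measurable_itv.
have IJ0 : I `&` J = set0.
  apply/seteqP; split => // z [].
  rewrite /I /J /= !in_itv/= => /andP[h _] h2.
  by have := le_lt_trans (le_trans h2 xy) h; rewrite ltxx.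
have leI : ((normal_peak 1 * expR (- y ^+ 2 / 2))%:E <= normal_prob (0 : R) 1 I)%E.
  have lI : lebesgue_measure I = 1%E.
    rewrite lebesgue_measure_itv/= lte_fin ltrBlDr ltrDl ltr01 -EFinB.
    by congr (_%:E); ring.
  rewrite -[leLHS]mule1 -lI -integral_cst//.
  apply: ge0_le_integral => //.
  - by move=> z _; rewrite lee_fin mulr_ge0 ?expR_ge0// normal_peak_ge0.
  - apply: measurable_funTS; apply/measurable_EFinP; exact: measurable_normal_pdf.
  - move=> z; rewrite /I/= in_itv/= => /andP[h1 h2].
    rewrite lee_fin normal_pdf_expE ?oner_neq0// ler_pM2l; last first.
      by apply: normal_peak_gt0; rewrite oner_neq0.
    by rewrite ler_expR expr1n subr0; nra.
apply: le_trans (leeD2r _ leI) _.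
rewrite -measureU//.
apply: (@probability_le1 _ (measurableTypeR R) R (normal_prob 0 1)).
exact: measurableU.
Qed.

End NormalTail.

(** * Hommel's procedure *)

Section HommelCombinatorics.
Context {R : realType} {n : nat}.
Implicit Types (p : 'I_n -> R) (alpha c : R).

(** Sorting preserves the number of entries at most [c] and puts them in front, at the positions,
    counted from 0, below that number. *)
Lemma lt_nth_sort (s : seq R) c m : (m < size s)%N ->
  (c < nth 0 (sort <=%R s) m) = (count (fun x => (x <= c)%R) s <= m)%N.
Proof.
move=> ms; set t := sort _ s.
have tsort : sorted <=%R t by apply: sort_sorted; exact: le_total.
have st : size t = size s by rewrite size_sort.
have -> : count (fun x => x <= c) s = count (fun x => x <= c) t.
  by apply/permP; rewrite perm_sym perm_sort.
have le_nth i j : (i <= j)%N -> (j < size t)%N -> nth 0 t i <= nth 0 t j.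
  by move=> ij jt; apply: sorted_leq_nth => //;
     rewrite ?inE//; [exact: le_trans | exact: (leq_ltn_trans ij)].
have [lt_c|le_c] := ltP.
- rewrite -(cat_take_drop m t) count_cat.
  have -> : count (fun x => x <= c) (drop m t) = 0%N.
    apply/eqP; rewrite eqn0Ngt -has_count -all_predC; apply/allP => x /(nthP 0)[i].
    rewrite size_drop => ilt <-; rewrite nth_drop /= -ltNge.
    apply: (lt_le_trans lt_c); apply: le_nth; first exact: leq_addr.
    by rewrite -ltn_subRL.
  rewrite addn0 (leq_trans (count_size _ _))// size_take.
  by case: ifP => // /negbT; rewrite -leqNgt.
- apply/esym/negbTE; rewrite -ltnNge -(cat_take_drop m.+1 t) count_cat.
  have -> : count (fun x => x <= c) (take m.+1 t) = m.+1.
    have sz : size (take m.+1 t) = m.+1 by rewrite size_takel// st.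
    rewrite -[RHS]sz; apply/eqP; rewrite -all_count; apply/allP => x /(nthP 0)[i].
    rewrite sz => im <-; rewrite nth_take//.
    by apply: le_trans le_c; apply: le_nth; rewrite ?st.
  by rewrite leq_addr.
Qed.

(** Replaces order statistics by cardinals of sublevel sets, the form used both for counting and for
    measurability. The 1-based index [m.+1] is position [m] of the sorted list. *)
Lemma lt_ordered_pvalue p c m : (m < n)%N ->
  (c < ordered_pvalue p m.+1) = (#|[set l | (p l <= c)%R]%SET| <= m)%N.
Proof.
move=> mn; rewrite /ordered_pvalue lt_nth_sort/=; last by rewrite size_map size_enum_ord.
congr (_ <= _)%N; rewrite count_map -sum1_count -sum1_card big_enum_cond/=.
by apply: eq_bigl => l; rewrite inE.
Qed.

(* k alpha / m <= alpha, so the m p-values above alpha pass every comparison. *)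
Lemma hommel_admissible_large alpha p : 0 < alpha ->
  let m := #|[set i | alpha < p i]%SET| in (0 < m)%N -> hommel_admissible alpha p m.
Proof.
move=> a0 m m0; apply/andP; split => //; apply/forallP => k.
have mn : (m <= n)%N by rewrite -[leqRHS]card_ord max_card.
have km := ltn_ord k.
apply: (@le_lt_trans _ _ alpha).
  by rewrite ler_pdivrMr ?ltr0n// mulrC ler_pM2l// ler_nat.
rewrite addnS lt_ordered_pvalue; last first.
  by rewrite -ltn_subRL subKn.
(* Exactly [n - m] p-values are at most [alpha], which is within the allowance [n - m + k]. *)
have -> : [set l | (p l <= alpha)%R]%SET = (~: [set i | (alpha < p i)%R])%SET.
  by apply/setP => l; rewrite !inE leNgt.
by rewrite cardsCs finset.setCK card_ord leq_addr.
Qed.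

(** As [m] is admissible, the branch rejecting everything is excluded and the maximal index [j] is
    at least [m]; hence the threshold [alpha / j] is at most [1 / m]. *)
Lemma hommel_reject_le alpha p i : 0 < alpha -> alpha < 1 ->
  let m := #|[set i | alpha < p i]%SET| in (0 < m)%N ->
  i \in hommel alpha p -> p i <= m%:R^-1.
Proof.
move=> a0 a1 m m0.
have mn : (m < n.+1)%N by rewrite ltnS -[leqRHS]card_ord max_card.
have adm := hommel_admissible_large alpha p a0 m0.
rewrite /hommel; have -> : [exists i : 'I_n.+1, hommel_admissible alpha p i].
  by apply/existsP; exists (Ordinal mn).
rewrite inE => /le_trans; apply.
have mj : (m <= hommel_index alpha p)%N.
  exact: (@leq_bigmax_cond _ _ (fun i : 'I_n.+1 => nat_of_ord i) (Ordinal mn) adm).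
have j0 := leq_trans m0 mj.
rewrite ler_pdivrMr ?ltr0n// (le_trans (ltW a1))// mulrC ler_pdivlMr ?ltr0n//.
by rewrite mul1r ler_nat.
Qed.

End HommelCombinatorics.

(** * Measurability of the event that a false hypothesis is rejected *)

Section HommelMeasurable.
Context {R : realType} {n : nat} {d} {T : measurableType d}.

Lemma measurable_set_cst (b : bool) : measurable [set _ : T | b].
Proof.
have [->|->] : [set _ : T | b] = setT \/ [set _ : T | b] = set0.
- by case: b; [left|right]; apply/seteqP; split.
- exact: measurableT.
- exact: measurable0.
Qed.

(** The event splits along the finitely many values of [g]; this allows a data-dependent choice,
    such as that of a critical value, to be frozen. *)
Lemma measurable_finType_fibers (I : finType) (g : T -> I) (B : I -> set T) :
  (forall y, measurable [set t | g t = y]) -> (forall y, measurable (B y)) ->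
  measurable [set t | B (g t) t].
Proof.
move=> mg mB.
have -> : [set t | B (g t) t] = \bigcup_(y in [set: I]) ([set t | g t = y] `&` B y).
  apply/seteqP; split => t /=; first by move=> h; exists (g t).
  by move=> [y _ [/= -> ]].
apply: fin_bigcup_measurable => [|y _]; first exact: finite_finset.
exact: measurableI.
Qed.

Lemma measurable_set_fibers (I : finType) (b : I -> T -> bool) :
  (forall i, measurable [set t | b i t]) ->
  forall A : {set I}, measurable [set t | [set i | b i t]%SET = A].
Proof.
move=> mb A.
have -> : [set t | [set i | b i t]%SET = A] =
    \bigcap_(i in [set: I]) [set t | b i t = (i \in A)].
  apply/seteqP; split => t /=; first by move=> <- i _ /=; rewrite inE.
  by move=> h; apply/setP => i; rewrite inE h.
apply: fin_bigcap_measurable => [|i _]; first exact: finite_finset.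
case: (i \in A); first exact: mb.
have -> : [set t | b i t = false] = ~` [set t | b i t].
  by apply/seteqP; split => t /=; [move=> -> | move/negP/negbTE].
exact: measurableC.
Qed.

(* By lt_ordered_pvalue the procedure depends on the p-values only through the
   finitely many sets {l | p_l <= c}, where c runs over the critical values. *)
Lemma measurable_hommel_true_positives (alpha : R) (mu : 'I_n -> R) (p : 'I_n -> T -> R) :
  (forall i, measurable_fun [set: T] (p i)) ->
  measurable [set t |
    (1 <= true_positives mu (hommel alpha (fun i => p i t)))%N].
Proof.
move=> mp.
have mle i c : measurable [set t | p i t <= c].
  by rewrite -[X in measurable X]setTI; exact: measurable_fun_le.
pose low c t := [set l | (p l t <= c)%R]%SET.
have mlow c (A : {set 'I_n}) : measurable [set t | low c t = A].
  exact: measurable_set_fibers.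
have madm (i : 'I_n.+1) : measurable [set t | hommel_admissible alpha (fun l => p l t) i].
  have [i0|i0] := posnP i.
    by rewrite i0 (_ : [set _ | _] = set0)//; apply/seteqP; split.
  have kn (k : 'I_i) : (n - i + k < n)%N.
    by rewrite -ltn_subRL subKn// -ltnS.
  have -> : [set t | hommel_admissible alpha (fun l => p l t) i] =
      \bigcap_(k in [set: 'I_i]) [set t | (#|low (k.+1%:R * alpha / i%:R)%R t| <= n - i + k)%N].
    apply/seteqP; split => t /=; rewrite /hommel_admissible i0 /=.
      by move=> /forallP h k _ /=; have := h k; rewrite addnS lt_ordered_pvalue.
    by move=> h; apply/forallP => k; rewrite addnS lt_ordered_pvalue//; exact: h.
  apply: fin_bigcap_measurable => [|k _]; first exact: finite_finset.
  exact: (measurable_finType_fibers _ (low _)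
     (fun A => [set t | (#|A| <= n - i + k)%N]) (mlow _) (fun=> measurable_set_cst _)).
pose adm t := [set i : 'I_n.+1 | hommel_admissible alpha (fun l => p l t) i]%SET.
(* Once the set [S] of admissible indices is frozen, the critical value is a constant. An empty [S]
   is the case in which everything is rejected. *)
pose rej (S : {set 'I_n.+1}) t : {set 'I_n} :=
  if S == finset.set0 then [set: 'I_n]%SET
  else low (alpha / (\max_(i in S) i)%:R) t.
have hommelE t : hommel alpha (fun i => p i t) = rej (adm t) t.
  rewrite /hommel /rej /low /hommel_index; case: ifPn => [/existsP[i hi]|].
    rewrite ifF; last by apply/negbTE/finset.set0Pn; exists i; rewrite inE.
    apply/setP => l; rewrite !inE; congr (_ <= _ / _%:R).
    by apply: eq_bigl => j; rewrite inE.
  rewrite negb_exists => /forallP h; rewrite ifT//.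
  by apply/eqP/setP => i; rewrite !inE (negbTE (h i)).
have -> : [set t | (1 <= true_positives mu (hommel alpha (fun i => p i t)))%N] =
    [set t | (fun S t => (1 <= true_positives mu (rej S t))%N) (adm t) t].
  by apply/seteqP; split => t /=; rewrite hommelE.
apply: (measurable_finType_fibers _ adm (fun S t => (1 <= true_positives mu (rej S t))%N)).
  exact: measurable_set_fibers.
move=> S; rewrite /rej; case: (S == finset.set0); first exact: measurable_set_cst.
exact: (measurable_finType_fibers _ (low _)
  (fun A => [set t | (1 <= true_positives mu A)%N]) (mlow _) (fun=> measurable_set_cst _)).
Qed.

End HommelMeasurable.

(** * Any-power *)

Section AnyPower.
Context {R : realType} {d} {T : measurableType d} {n : nat}.
Implicit Types (mu : 'I_n -> R) (Y : 'I_n -> T -> R).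

(** A truncation argument: with [W i = expR (- theta * residual Y i w)], an index outside the set
    contributes at most [expR (theta * L)], and any [W i] is at most [D + W i ^+ 2 / D]. Summing,
    the surplus [n] in the first moment is less than [#|S| * D + n / 2]. *)
Lemma large_pvalues_card Y mu (alpha theta L D M K c : R) w : (0 < n)%N ->
  0 < theta -> 0 < D -> (forall i, mu i <= M) -> M + K - c <= L ->
  (forall x, x <= c -> alpha < pvalue x) ->
  average Y w < K ->
  expR (theta * L) + 1 < (\sum_i expR (- theta * residual Y i w)) / n%:R ->
  (\sum_i expR (- theta * residual Y i w) ^+ 2) / n%:R < D / 2 ->
  n%:R / (2 * D) < #|[set i | alpha < pvalue (Y i w + mu i)]%SET|%:R.
Proof.
move=> n0 theta0 D0 muM hL hc hK lo hi.
have npos : 0 < n%:R :> R by rewrite ltr0n.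
set S := [set i | _]%SET; set W := fun i => expR (- theta * residual Y i w).
have pointwise i : W i - expR (theta * L) <= (i \in S)%:R * D + W i ^+ 2 / D.
  have [small|large] := ltP (residual Y i w) (- L).
    (* Here [Y i w + mu i < - L + K + M <= c]. *)
    have -> : i \in S.
      rewrite inE; apply: hc; have := muM i; move: small hK hL.
      rewrite /residual; lra.
    have W0 : 0 <= W i by exact: expR_ge0.
    have E0 : 0 <= expR (theta * L) by exact: expR_ge0.
    have : W i <= D + W i ^+ 2 / D.
      rewrite -subr_ge0 (_ : _ - _ = ((W i - D) ^+ 2 + D * W i) / D); last first.
        by field; rewrite gt_eqF.
      by rewrite divr_ge0 ?(ltW D0)// addr_ge0 ?sqr_ge0// mulr_ge0// ltW.
    by rewrite mul1r; lra.
  have : W i <= expR (theta * L) by rewrite ler_expR; nra.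
  have : 0 <= W i ^+ 2 / D by rewrite divr_ge0 ?sqr_ge0// ltW.
  have : 0 <= (i \in S)%:R * D by rewrite mulr_ge0// ltW.
  lra.
have sumle : \sum_i (W i - expR (theta * L)) <= \sum_i ((i \in S)%:R * D + W i ^+ 2 / D).
  by apply: ler_sum => i _; exact: pointwise.
move: sumle; rewrite sumrB big_split/= -!mulr_suml sumr_const card_ord -mulr_natl.
have -> : \sum_i (i \in S)%:R = #|S|%:R :> R.
  by rewrite -natr_sum -sum1_card; congr (_%:R); rewrite [RHS]big_mkcond;
     apply: eq_bigr => i _; case: (i \in S).
move: lo hi; rewrite ltr_pdivlMr// ltr_pdivrMr// => lo hi sumle.
have hi' : (\sum_i W i ^+ 2) / D < n%:R / 2.
  by rewrite ltr_pdivrMr//; apply: lt_le_trans hi _; lra.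
rewrite ltr_pdivrMr ?mulr_gt0//; move: lo; rewrite -/W.
nra.
Qed.

(** With [m] p-values above [alpha] and [m > n / (2 * D)], a rejected p-value is at most
    [1 / m < 2 * D / n]. But the bound on the residuals keeps every [Y i w + mu i] below [y - 1],
    and [pvalue_lower_bound] then puts every p-value above that level. *)
Lemma hommel_no_rejection Y mu (alpha theta L D M K c y : R) w : (0 < n)%N ->
  0 < alpha -> alpha < 1 ->
  0 < theta -> 0 < D -> (forall i, mu i <= M) -> M + K - c <= L ->
  (forall x, x <= c -> alpha < pvalue x) ->
  average Y w < K ->
  expR (theta * L) + 1 < (\sum_i expR (- theta * residual Y i w)) / n%:R ->
  (\sum_i expR (- theta * residual Y i w) ^+ 2) / n%:R < D / 2 ->
  1 <= y -> 2 * D / n%:R <= normal_peak 1 * expR (- y ^+ 2 / 2) ->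
  (forall i, residual Y i w < y - 1 - M - K) ->
  hommel alpha (fun i => pvalue (Y i w + mu i)) = finset.set0.
Proof.
move=> n0 a0 a1 theta0 D0 muM hL hc hK lo hi y1 hy hr.
have npos : 0 < n%:R :> R by rewrite ltr0n.
have big := large_pvalues_card _ _ _ _ _ _ _ _ _ _ n0 theta0 D0 muM hL hc hK lo hi.
have frac0 : 0 < n%:R / (2 * D) by rewrite divr_gt0// mulr_gt0.
have m0 : (0 < #|[set i | (alpha < pvalue (Y i w + mu i))%R]%SET|)%N.
  by rewrite -(ltr0n R); exact: lt_trans big.
apply/eqP/negPn/negP => /finset.set0Pn[i /(hommel_reject_le _ _ _ a0 a1 m0)].
apply/negP; rewrite -ltNge.
apply: (@lt_le_trans _ _ (2 * D / n%:R)).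
  rewrite -[ltRHS]invrK invf_div ltf_pV2 ?posrE//.
  by rewrite ltr0n.
apply: le_trans hy _; apply: pvalue_lower_bound => //.
have := hr i; have := muM i; move: hK; rewrite /residual; lra.
Qed.

Context (P : probability T R) (rho : R).

(** The four summands bound the probabilities of the exceptional events [E1], [E2], [E3] and [E4],
    outside of which nothing is rejected. *)
Lemma any_power_bound Y mu (alpha theta L D M K c y : R) : (0 < n)%N ->
  0 < rho -> rho < 1 ->
  (forall i, measurable_fun [set: T] (Y i)) ->
  (forall a : 'I_n -> R,
    (\int[P]_w (expR (\sum_i a i * Y i w))%:E =
     (expR (((1 - rho) * \sum_i a i ^+ 2 + rho * (\sum_i a i) ^+ 2) / 2))%:E)%E) ->
  0 < alpha -> alpha < 1 ->
  0 < theta -> 0 < D -> (forall i, mu i <= M) -> M + K - c <= L ->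
  (forall x, x <= c -> alpha < pvalue x) ->
  expR (theta * L) + 2 <= expR (theta ^+ 2 * (@residual_variance R n rho) / 2) ->
  1 <= y -> 2 * D / n%:R <= normal_peak 1 * expR (- y ^+ 2 / 2) ->
  (any_power P (hommel alpha) mu (fun i w => Y i w + mu i)%R
   <= (expR (1 / 2 - K) + expR (2 * theta ^+ 2) / n%:R + 2 * expR (2 * theta ^+ 2) / D
      + n%:R * expR (y ^+ 2 * (1 - rho) / 2 - y * (y - 1 - M - K)))%:E)%E.
Proof.
move=> n0 rho0 rho1 mY mgfY a0 a1 theta0 D0 muM hL hc hA y1 hy.
have npos : 0 < n%:R :> R by rewrite ltr0n.
set v := y - 1 - M - K.
have := average_upper_tail P rho Y n0 rho1 mY mgfY K.
have := average_exp_lower_tail P rho Y n0 rho0 rho1 mY mgfY theta.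
have := average_sqr_exp_upper_tail P rho Y n0 rho0 rho1 mY mgfY theta D D0.
(* The Chernoff parameter is [y] itself. The leading exponent [- (1 + rho) * y ^+ 2 / 2] then
   outweighs the factor [n], which is of order [expR (y ^+ 2 / 2)] for the [y] chosen later. *)
have := residual_max_upper_tail P rho Y n0 rho1 mY mgfY y v (lt_le_trans ltr01 y1).
set E1 := [set w | K <= _]; set E2 := [set w | _ <= _ - 1]; set E3 := [set w | D / 2 <= _].
set E4 := \big[setU/set0]_(i < n) _ => P4 P3 P2 P1.
rewrite !EFinD.
apply: (@le_trans _ _ (P E1 + P E2 + P E3 + P E4)%E); last by rewrite !leeD.
have mres i : measurable_fun [set: T] (fun w => expR (- theta * residual Y i w)).
  apply: measurableT_comp => //; apply: measurable_funM => //.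
  exact: measurable_residual.
have mE1 : measurable E1.
  rewrite -[X in measurable X]setTI; apply: measurable_fun_le => //.
  exact: measurable_average.
have mE2 : measurable E2.
  rewrite -[X in measurable X]setTI; apply: measurable_fun_le => //.
  by apply: measurable_funM => //; exact: measurable_sum.
have mE3 : measurable E3.
  rewrite -[X in measurable X]setTI; apply: measurable_fun_le => //.
  apply: measurable_funM => //; apply: measurable_sum => i; exact: measurable_funX.
have mE4 : measurable E4.
  apply: bigsetU_measurable => i _.
  rewrite -[X in measurable X]setTI; apply: measurable_fun_le => //.
  exact: measurable_residual.
have mE12 : measurable (E1 `|` E2) by exact: measurableU.
have mE123 : measurable (E1 `|` E2 `|` E3) by exact: measurableU.
apply: (@le_trans _ _ (P (E1 `|` E2 `|` E3 `|` E4))).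
  apply: le_measure; rewrite ?inE.
  - apply: (measurable_hommel_true_positives alpha mu (fun i w => pvalue (Y i w + mu i))) => i.
    apply: (measurableT_comp measurable_pvalue); exact: measurable_funD.
  - exact: measurableU.
  move=> w /= rejected; apply: contrapT => notE.
  have nE1 : average Y w < K.
    by rewrite ltNge; apply/negP => h; apply: notE; left; left; left.
  have nE2 : expR (theta * L) + 1 < (\sum_i expR (- theta * residual Y i w)) / n%:R.
    (* The 2 in the gap hypothesis is spent here: one unit on the deviation from the mean, one on
       the surplus that the counting argument needs. *)
    rewrite ltNge; apply/negP => h; apply: notE; left; left; right => /=.
    by apply: (le_trans h); lra.
  have nE3 : (\sum_i expR (- theta * residual Y i w) ^+ 2) / n%:R < D / 2.
    by rewrite ltNge; apply/negP => h; apply: notE; left; right.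
  have nE4 i : residual Y i w < v.
    rewrite ltNge; apply/negP => h; apply: notE; right.
    by rewrite /E4 (bigD1 i)//=; left.
  move: rejected.
  rewrite (hommel_no_rejection Y mu alpha theta L D M K c y)//.
  rewrite /true_positives (_ : [set i in _ | _]%SET = finset.set0) ?cards0//.
  by apply/setP => i; rewrite !inE.
apply: (le_trans (measureU2 _ _ _)) => //; apply: leeD => //.
apply: (le_trans (measureU2 _ _ _)) => //; apply: leeD => //.
exact: measureU2.
Qed.

End AnyPower.

(** * Elementary estimates, choice of the parameters and passage to the limit *)

Lemma expR_gap {R : realType} (theta L s : R) : 1 <= theta -> 0 <= L ->
  2 * theta * (L + 2) <= theta ^+ 2 * s ->
  expR (theta * L) + 2 <= expR (theta ^+ 2 * s / 2).
Proof.
move=> theta1 L0 hs.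
(* The factor [expR (2 * theta)] is at least 3 and [expR (theta * L)] at least 1, so their product
   exceeds the latter by at least 2. *)
apply: (@le_trans _ _ (expR (theta * L + 2 * theta))); last by rewrite ler_expR; lra.
rewrite expRD; have := expR_ge1Dx (theta * L); have := expR_ge1Dx (2 * theta).
have : 0 <= theta * L by rewrite mulr_ge0//; lra.
set a := expR (theta * L); set b := expR _ => tL hb ha.
have : a * (1 + 2 * theta) <= a * b by rewrite ler_wpM2l//; lra.
nra.
Qed.

(** The lower bound on [y] gives [rho * y / 2 >= |B| + 1]: the part [|B|] absorbs the linear term,
    and 1 is left over. *)
Lemma gaussian_exponent_le {R : realType} (rho B y : R) : 0 < rho ->
  2 * (`|B| + 1) / rho <= y -> - rho * y ^+ 2 / 2 + y * B <= - y.
Proof.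
move=> rho0; rewrite ler_pdivrMr// => hy.
have B0 := normr_ge0 B; have BB := ler_norm B.
have y0 : 0 <= y by rewrite -(pmulr_lge0 _ rho0); apply: le_trans hy; lra.
have : 0 <= y * (y * rho - 2 * (`|B| + 1)) by rewrite mulr_ge0//; lra.
have : y * B <= y * `|B| by exact: ler_wpM2l.
nra.
Qed.

(** Substituting [N = expR (y ^+ 2 / 2) / kappa] leaves the exponent [- rho * y ^+ 2 / 2 + y * B].
    This is where positive correlation wins: the residuals have less variance than the
    observations. *)
Lemma maximum_tail_le {R : realType} (rho B kappa e y N : R) :
  0 < rho -> 0 < kappa -> 0 < e -> expR (y ^+ 2 / 2) = N * kappa ->
  2 * (`|B| + 1) / rho <= y -> ln (kappa * e)^-1 <= y ->
  N * expR (y ^+ 2 * (1 - rho) / 2 - y * (y - B)) <= e.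
Proof.
move=> rho0 kappa0 e0 ey yB ylog.
have ke0 : 0 < (kappa * e)^-1 by rewrite invr_gt0 mulr_gt0.
have -> : N = expR (y ^+ 2 / 2) / kappa by rewrite ey mulfK// gt_eqF.
rewrite mulrAC -expRD.
have -> : y ^+ 2 / 2 + (y ^+ 2 * (1 - rho) / 2 - y * (y - B)) =
    - rho * y ^+ 2 / 2 + y * B by field.
rewrite ler_pdivrMr//; apply: (@le_trans _ _ (expR (- y))).
  by rewrite ler_expR; exact: gaussian_exponent_le.
rewrite expRN [e * _]mulrC -[leRHS]invrK lef_pV2 ?posrE ?expR_gt0//.
by rewrite -[leLHS]lnK ?posrE// ler_expR.
Qed.

Lemma cvge0_of_near_le {R : realType} (f : nat -> \bar R) : (forall n, 0 <= f n)%E ->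
  (forall e : R, 0 < e -> \forall n \near \oo, (f n <= e%:E)%E) ->
  f n @[n --> \oo] --> (0%E : \bar R).
Proof.
move=> f0 fe.
have fin : \forall n \near \oo, f n \is a fin_num.
  near=> n; rewrite ge0_fin_numE//; apply: (@le_lt_trans _ _ 1%E); last exact: ltry.
  by near: n; exact: (fe 1 ltr01).
apply/fine_cvgP; split => //; apply/cvgr0Pnorm_le => e e0.
near=> n; have fn : f n \is a fin_num by near: n.
rewrite ger0_norm ?fine_ge0// -lee_fin fineK//.
by near: n; exact: fe.
Unshelve. all: by end_near. Qed.

Theorem corollary6p3 (R : realType) (rho : R) (hrho : 0 < rho < 1)
  (mu : nat -> R) (hmu : forall i : nat, 0 <= mu i)
  (d : nat -> measure_display) (T : forall n : nat, measurableType (d n))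
  (P : forall n : nat, probability (T n) R)
  (X : forall n : nat, 'I_n -> {RV (P n) >-> R})
  (hnormal : forall n : nat,
     jointly_normal (P n) (fun i : 'I_n => X n i : T n -> R))
  (hmarginal : forall (n : nat) (i : 'I_n),
     has_normal_law (P n) (X n i) (mu i) 1)
  (hcorr : forall (n : nat) (i j : 'I_n), i != j ->
     correlation (P n) (X n i) (X n j) = rho)
  (hsup : ereal_sup [set (mu i)%:E | i in [set: nat]] \is a fin_num)
  (alpha : R) (halpha : 0 < alpha < 1) :
  (fun n : nat =>
     any_power (P n) (hommel alpha) (fun i : 'I_n => mu i)
       (fun i : 'I_n => X n i : T n -> R)) @ \oo --> (0%E : \bar R).
Proof.
have [rho0 rho1] := andP hrho; have [a0 a1] := andP halpha.
pose M := fine (ereal_sup [set (mu i)%:E | i in [set: nat]]).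
have muM i : mu i <= M.
  by rewrite -lee_fin fineK//; apply: ereal_sup_ubound; exists i.
have [c hc] := pvalue_gt alpha a1.
apply: cvge0_of_near_le => [n|e e0]; first exact: measure_ge0.
have e40 : 0 < e / 4 by lra.
(* Each of the four error terms gets [e / 4]; this [K] makes the one of the average equal to it. *)
pose K := 1 / 2 - ln (e / 4).
(* The absolute value makes [L] nonnegative, as [expR_gap] requires. *)
pose L := `|M + K - c|.
have L0 : 0 <= L by exact: normr_ge0.
(* Solves [theta ^+ 2 * ((1 - rho) / 2) = 2 * theta * (L + 2)], where [(1 - rho) / 2] bounds the
   residual variance from below once [n >= 2]. *)
pose theta := 4 * (L + 2) / (1 - rho).
have theta8 : 8 <= theta.
  by rewrite ler_pdivlMr ?subr_gt0//; nra.
pose E := expR (2 * theta ^+ 2).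
have E0 : 0 < E by exact: expR_gt0.
(* Makes [2 * E / D] equal to [e / 4]. *)
pose D := 8 * E / e.
have D0 : 0 < D by rewrite divr_gt0// mulr_gt0.
have peak0 : 0 < normal_peak 1 :> R by apply: normal_peak_gt0; rewrite oner_neq0.
pose kappa := normal_peak 1 / (2 * D).
have kappa0 : 0 < kappa by rewrite divr_gt0// mulr_gt0.
pose B := 1 + M + K.
(* A single lower bound for [y], collecting those required by [pvalue_lower_bound] and
   [maximum_tail_le]. *)
pose Y0 := 1 + 2 * (`|B| + 1) / rho + `|ln (kappa * (e / 4))^-1|.
have YB : 0 <= 2 * (`|B| + 1) / rho by rewrite divr_ge0 ?(ltW rho0)// mulr_ge0// addr_ge0.
have Yln := normr_ge0 (ln (kappa * (e / 4))^-1).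
have ln_le := ler_norm (ln (kappa * (e / 4))^-1).
have Y01 : 1 <= Y0 by rewrite /Y0; lra.
have Y0B : 2 * (`|B| + 1) / rho <= Y0 by rewrite /Y0; lra.
have Y0log : ln (kappa * (e / 4))^-1 <= Y0 by rewrite /Y0; lra.
near=> n.
have n2 : (2 <= n)%N by near: n; exact: nbhs_infty_ge.
have nE : 4 * E / e <= n%:R by near: n; exact: nbhs_infty_ger.
have nY : expR (Y0 ^+ 2 / 2) / kappa <= n%:R by near: n; exact: nbhs_infty_ger.
have n0 : (0 < n)%N by exact: ltn_trans n2.
have npos : 0 < n%:R :> R by rewrite ltr0n.
have nk0 : 0 < n%:R * kappa by rewrite mulr_gt0.
(* This [y] satisfies [expR (y ^+ 2 / 2) = n%:R * kappa], so the lower bound on the p-values equals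
   the level [2 * D / n%:R] exactly. *)
pose y := Num.sqrt (2 * ln (n%:R * kappa)).
have lnY : Y0 ^+ 2 / 2 <= ln (n%:R * kappa).
  by rewrite -ler_expR lnK ?posrE// -ler_pdivrMr.
have Y0y : Y0 <= y.
  rewrite -[Y0]ger0_norm; last lra.
  by rewrite -sqrtr_sqr; apply: ler_wsqrtr; lra.
have y2 : y ^+ 2 = 2 * ln (n%:R * kappa).
  by rewrite sqr_sqrtr//; have := sqr_ge0 Y0; lra.
have ey : expR (y ^+ 2 / 2) = n%:R * kappa.
  by rewrite y2 mulrC mulrA mulVf// mul1r lnK// posrE.
have y1 : 1 <= y by exact: le_trans Y0y.
pose Y (i : 'I_n) w := X n i w - mu i.
have -> : (fun i : 'I_n => X n i : T n -> R) = (fun i w => Y i w + mu i).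
  by apply/funext => i; apply/funext => w; rewrite subrK.
have mX (i : 'I_n) : measurable_fun [set: T n] (X n i) by [].
have mY i : measurable_fun [set: T n] (Y i) by exact: measurable_funB.
have mgfY := equicorrelated_mgf (P n) rho (fun i : 'I_n => mu i) (fun i => X n i) mX
  (hnormal n) (hmarginal n) (hcorr n).
have hA : expR (theta * L) + 2 <= expR (theta ^+ 2 * (@residual_variance R n rho) / 2).
  apply: expR_gap => //; first lra.
  have : (1 - rho) / 2 <= @residual_variance R n rho.
    rewrite /residual_variance ler_pM2l ?subr_gt0//.
    have : n%:R^-1 <= 2^-1 :> R by rewrite lef_pV2 ?posrE// ler_nat.
    lra.
  have theta2 : 0 <= theta ^+ 2 by exact: sqr_ge0.
  move/(ler_wpM2l theta2); apply: le_trans.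
  rewrite (_ : theta ^+ 2 * ((1 - rho) / 2) = 2 * theta * (L + 2))//.
  by rewrite /theta; field; rewrite gt_eqF// subr_gt0.
have hy : 2 * D / n%:R <= normal_peak 1 * expR (- y ^+ 2 / 2).
  rewrite mulNr expRN ey /kappa le_eqVlt; apply/orP; left; apply/eqP.
  by field; rewrite !gt_eqF.
apply: le_trans (any_power_bound (P n) rho Y (fun i => mu i) alpha theta L D M K c y
  n0 rho0 rho1 mY mgfY a0 a1 _ D0 (fun i => muM i) (ler_norm _) hc hA y1 hy) _.
  by lra.
rewrite lee_fin -/E.
have -> : 1 / 2 - K = ln (e / 4) by rewrite /K; ring.
rewrite lnK ?posrE//.
have -> : 2 * E / D = e / 4 by rewrite /D; field; rewrite !gt_eqF.
have h2 : E / n%:R <= e / 4.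
  by move: nE; rewrite !ler_pdivrMr//; lra.
have h4 : n%:R * expR (y ^+ 2 * (1 - rho) / 2 - y * (y - 1 - M - K)) <= e / 4.
  have -> : y - 1 - M - K = y - B by rewrite /B; ring.
  apply: (maximum_tail_le _ _ _ _ _ _ rho0 kappa0 e40 ey).
  - exact: le_trans Y0y.
  - exact: le_trans Y0y.
apply: (@le_trans _ _ (e / 4 + e / 4 + e / 4 + e / 4)).
  exact: (lerD (lerD (lerD (lexx _) h2) (lexx _)) h4).
by rewrite le_eqVlt; apply/orP; left; apply/eqP; field.
Unshelve. all: by end_near. Qed.
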